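(* Let $p=(p_1,\ldots,p_n)$ and $q=(q_1,\ldots,q_n)$ be two points of $\mathbb{R}^n$, let $i\in\{1,\ldots,n\}$ and $\varepsilon\in\{+1,-1\}$ be such that $q\in S_i^{\varepsilon}(p)$, and let $\alpha:[0,1]\to\mathbb{R}^n$ be a natural path in $(\mathbb{R}^n,d_\infty)$ with $\alpha(0)=p$ and $\alpha(1)=q$. Then $\alpha$ is a geodesic in $(\mathbb{R}^n,d_\infty)$ if and only if $\alpha(t')\in S_i^{\varepsilon}(\alpha(t))$ for all $t,t'\in[0,1]$ with $t<t'$.
   Context: $d_\infty$ is the maximum metric on $\mathbb{R}^n$: $d_\infty(x,y)=\max_{1\le k\le n}|x_k-y_k|$. For $p\in\mathbb{R}^n$, $i\in\{1,\ldots,n\}$ and $\varepsilon=\pm1$, the sector of $p$ is $S_i^{\varepsilon}(p)=\{q\in\mathbb{R}^n : d_\infty(p,q)=\varepsilon(q_i-p_i)\}$. A path in a metric space $(X,d)$ is a continuous map $\alpha:[0,1]\to X$. Its length is $L(\alpha)=\sup\sum_{j=1}^m d(\alpha(t_{j-1}),\alpha(t_j))$, the supremum being over all partitions $0=t_0<t_1<\cdots<t_m=1$ of $[0,1]$; the length of a restriction $\alpha|_{[0,t]}$ is defined in the same way using partitions of $[0,t]$. The path $\alpha$ is called natural if $L(\alpha|_{[0,t]})=t\cdot L(\alpha)$ for all $t\in(0,1)$. The path $\alpha$ is called a geodesic if it is natural and $L(\alpha)=d(\alpha(0),\alpha(1))$. *)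

(* Defs.v *)
From HB Require Import structures.
From mathcomp Require Import all_boot all_order all_algebra.
From mathcomp Require Import all_classical all_reals all_analysis.

Set Implicit Arguments.
Unset Strict Implicit.
Unset Printing Implicit Defensive.

Import Order.TTheory GRing.Theory Num.Theory.
Import numFieldNormedType.Exports.

Local Open Scope classical_set_scope.
Local Open Scope ring_scope.

Definition dinf (R : realType) (n : nat) (x y : 'rV[R]_n) : R :=
  \big[Num.max/0]_(k < n) `|x ord0 k - y ord0 k|.

Section dinf_metric.
Context (R : realType) (n : nat).
Implicit Types x y : 'rV[R]_n.

Lemma dinf_norm x y : dinf x y = `|x - y|.
Proof.
rewrite /dinf [RHS]/Num.norm /= mx_normrE.
apply/eqP; rewrite eq_le; apply/andP; split.
  apply: bigmax_le => [|k _]; first exact: bigmax_ge_id.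
  apply: le_trans (le_bigmax 0
    (fun ij : 'I_1 * 'I_n => `|(x - y) ij.1 ij.2|) (ord0, k)).
  by rewrite !mxE.
apply: bigmax_le => [|[j k] _ /=]; first exact: bigmax_ge_id.
rewrite !mxE (ord1 j).
exact: (le_bigmax 0 (fun k => `|x ord0 k - y ord0 k|)).
Qed.

Let dinf_ge0 x y : 0 <= dinf x y.
Proof. by rewrite dinf_norm. Qed.

Let dinf_positivity x y : dinf x y = 0 -> x = y.
Proof. by rewrite dinf_norm => /eqP; rewrite normr_eq0 subr_eq0 => /eqP. Qed.

Let ballEdinf x (e : R) : ball x e = [set y | dinf x y < e].
Proof.
by rewrite -ball_normE; apply/seteqP; split=> y /=; rewrite dinf_norm.
Qed.

(* dinf is installed as the distance of the library's (sup-norm) topology on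
   'rV[R]_n, so that continuity below is continuity for dinf. *)
HB.instance Definition _ := @PseudoMetric_isMetric.Build R 'rV[R]_n
  (@dinf R n) dinf_ge0 dinf_positivity ballEdinf.

Lemma mdist_dinf x y : mdist x y = dinf x y.
Proof. by []. Qed.

End dinf_metric.

Definition sector (R : realType) (n : nat) (i : 'I_n) (eps : R)
    (p : 'rV[R]_n) : set 'rV[R]_n :=
  [set q | dinf p q = eps * (q ord0 i - p ord0 i)].

Section paths.
Context (R : realType) (X : metricType R).
Implicit Type alpha : R -> X.

(* A path is a total function on R of which only the values on [0, 1] matter. *)
Definition is_path alpha : Prop := {within `[0, 1], continuous alpha}.

(* Length of the restriction of alpha to [a, b]; possibly +oo.  The points of
   the partition are those of a :: s, and s ends with b. *)
Definition path_length alpha (a b : R) : \bar R :=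
  ereal_sup [set (\sum_(0 <= j < size s)
      mdist (alpha (nth b (a :: s) j)) (alpha (nth b (a :: s) j.+1)))%:E
    | s in itv_partition a b].

Definition is_natural alpha : Prop :=
  is_path alpha /\
  forall t : R, 0 < t < 1 ->
    path_length alpha 0 t = (t%:E * path_length alpha 0 1)%E.

Definition is_geodesic alpha : Prop :=
  is_natural alpha /\
  path_length alpha 0 1 = (mdist (alpha 0) (alpha 1))%:E.

End paths.

(* Main.v *)
Require Import Defs.
From mathcomp Require Import all_boot all_order all_algebra.
From mathcomp Require Import all_classical all_reals all_analysis.
From mathcomp Require Import lra.
Import Order.TTheory GRing.Theory Num.Theory.
Import numFieldNormedType.Exports.
Local Open Scope classical_set_scope.
Local Open Scope ring_scope.

(** The signed coordinate [g t = eps * alpha t ord0 i] calibrates the path: its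
    increments never exceed the [dinf]-distances, and [sector i eps x y] says
    exactly that the increment from [x] to [y] attains the distance.  Over any
    partition the increments of [g] telescope to [g 1 - g 0], which is
    [dinf p q] because [q] lies in the sector of [p].  So if every pair of
    points attains its bound, every partition sum equals [dinf p q], and so does
    the length.  Conversely, if the length is [dinf p q], no partition sum
    exceeds the telescoping sum; a partition having [t] and [t'] as consecutive
    points then leaves no room for a strict inequality between them.  This is
    [path_length_calibrated], valid for any real function [g] whose increments
    are bounded by the distances. *)

Lemma itv_partition_telescope {R : realType} (g : R -> R) {a b : R}
    {s : seq R} :
  itv_partition a b s ->
  \sum_(0 <= j < size s) (g (nth b (a :: s) j.+1) - g (nth b (a :: s) j))
    = g b - g a.
Proof.
move=> [_ /eqP sb].
by rewrite (telescope_sumr (fun j => g (nth b (a :: s) j))) // nth_last /= sb.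
Qed.

(** The increments of [g] bound the distances from below and telescope along
    any partition, so the length is at least [g b - g a]; it equals that value
    only if no distance between two successive partition points exceeds the
    increment of [g], and any two points of the interval are successive in some
    partition. *)
Lemma path_length_calibrated {R : realType} {X : metricType R}
    (alpha : R -> X) (g : R -> R) (a b : R) :
  a < b ->
  (forall t t', g t' - g t <= mdist (alpha t) (alpha t')) ->
  path_length alpha a b = (g b - g a)%:E <->
  (forall t t', a <= t -> t < t' -> t' <= b ->
     mdist (alpha t) (alpha t') = g t' - g t).
Proof.
move=> ab gd; split=> [lenE t t' at_ tt' t'b | gE].
  have sum_le s : itv_partition a b s ->
      \sum_(0 <= j < size s)
        mdist (alpha (nth b (a :: s) j)) (alpha (nth b (a :: s) j.+1))
      <= g b - g a.
    move=> sP; rewrite -lee_fin -lenE.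
    by apply: ereal_sup_ubound; exists s.
  apply/eqP; rewrite eq_le gd andbT.
  have g_at := gd a t; have g_t'b := gd t' b.
  (* Partition points must be distinct, so [t] is inserted only if it differs
     from [a], and [t'] only if it differs from [b]. *)
  have [ta|ta] := eqVneq a t; have [tb|tb] := eqVneq t' b.
  - have /sum_le : itv_partition a b [:: b] by split; rewrite //= ab.
    by rewrite /= big_nat1 /= -ta tb.
  - have tb' : t' < b by rewrite lt_neqAle tb.
    have /sum_le : itv_partition a b [:: t'; b].
      by split; rewrite //= tb' ta tt'.
    by rewrite /= big_nat_recr //= big_nat1 /= -ta; lra.
  - have ta' : a < t by rewrite lt_neqAle ta.
    have /sum_le : itv_partition a b [:: t; b].
      by split; rewrite //= ta' -tb tt'.
    by rewrite /= big_nat_recr //= big_nat1 /= tb; lra.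
  - have ta' : a < t by rewrite lt_neqAle ta.
    have tb' : t' < b by rewrite lt_neqAle tb.
    have /sum_le : itv_partition a b [:: t; t'; b].
      by split; rewrite //= ta' tt' tb'.
    by rewrite /= 2?big_nat_recr //= big_nat1 /=; lra.
rewrite /path_length; set sums := (X in ereal_sup X).
suff -> : sums = [set (g b - g a)%:E] by rewrite ereal_sup1.
have sumE s : itv_partition a b s ->
    \sum_(0 <= j < size s)
      mdist (alpha (nth b (a :: s) j)) (alpha (nth b (a :: s) j.+1))
    = g b - g a.
  move=> sP; rewrite -(itv_partition_telescope g sP).
  apply: eq_big_nat => j /andP[_ js]; have [lt_s _] := sP.
  apply: gE; first exact: (itv_partition_nth_ge (ltnW js) sP).
    by move/(pathP b): lt_s; apply.
  exact: (@itv_partition_nth_le _ _ _ _ _ j.+1 js sP).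
apply/seteqP; split=> [_ [s sP <-] | _ ->] /=; first by rewrite sumE.
have bP : itv_partition a b [:: b] by split; rewrite //= ab.
by exists [:: b]; rewrite // sumE.
Qed.

Lemma signed_coord_le_dinf {R : realType} {n : nat} (i : 'I_n) (eps : R)
    (x y : 'rV[R]_n) :
  eps = 1 \/ eps = -1 -> eps * (y ord0 i - x ord0 i) <= dinf x y.
Proof.
move=> heps; apply: (@le_trans _ _ `|x ord0 i - y ord0 i|).
  case: heps => ->; first by rewrite mul1r distrC ler_norm.
  by rewrite mulN1r opprB ler_norm.
exact: (le_bigmax 0 (fun k => `|x ord0 k - y ord0 k|)).
Qed.

Theorem theorem1 (R : realType) (n : nat) (p q : 'rV[R]_n) (i : 'I_n) (eps : R)
    (heps : eps = 1 \/ eps = -1) (hq : sector i eps p q)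
    (alpha : R -> 'rV[R]_n) (hnat : is_natural alpha)
    (h0 : alpha 0 = p) (h1 : alpha 1 = q) :
  is_geodesic alpha <->
  (forall t t' : R, 0 <= t <= 1 -> 0 <= t' <= 1 -> t < t' ->
     sector i eps (alpha t) (alpha t')).
Proof.
pose g t := eps * alpha t ord0 i.
have gd t t' : g t' - g t <= mdist (alpha t) (alpha t').
  by rewrite /g -mulrBr mdist_dinf signed_coord_le_dinf.
have pq : mdist (alpha 0) (alpha 1) = g 1 - g 0.
  by rewrite /g -mulrBr h0 h1 mdist_dinf.
have lenP := path_length_calibrated alpha g 0 1 ltr01 gd.
split=> [[_ len] t t' /andP[t0 _] /andP[_ t'1] tt' | sec].
  rewrite /sector /= mulrBr -mdist_dinf.
  by rewrite pq in len; apply: (lenP.1 len).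
split=> //; rewrite pq; apply: lenP.2 => t t' t0 tt' t'1.
rewrite /g -mulrBr mdist_dinf; apply: sec => //; apply/andP; split=> //.
  exact: le_trans (ltW tt') t'1.
exact: le_trans t0 (ltW tt').
Qed.
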